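(* Let $G=(V,E)$ be a connected finite graph with positive vertex measure $\mu$ and positive symmetric edge weights $w_{xy}$. Let $h_1:V\to\mathbb{R}$ be a positive function, let $h_2:V\to\mathbb{R}$ be a function, and let $A,B>0$ be two constants. Let $\mathbf{d}_{h_1,h_2}$ be the topological degree (defined in the context) of the map $\mathcal{F}_{h_1,h_2}(u)=-\Delta u+h_1e^{Au}+h_2e^{-Bu}$. Then $$\mathbf{d}_{h_1,h_2}=\begin{cases}1, & \text{if } \max_V h_2<0,\\ 0, & \text{if } \min_V h_2>0.\end{cases}$$
   Context: $G=(V,E)$ is a connected finite graph with measure $\mu:V\to(0,+\infty)$ and weights $\{w_{xy}:xy\in E\}$, where $w_{xy}=w_{yx}>0$. The Laplacian of $u:V\to\mathbb{R}$ is $$\Delta u(x)=\frac{1}{\mu(x)}\sum_{y\sim x}w_{xy}(u(y)-u(x)),$$ where $y\sim x$ means $xy\in E$. $L^\infty(V)$ is the finite-dimensional space of all functions $u:V\to\mathbb{R}$ with norm $\|u\|_\infty=\max_{x\in V}|u(x)|$ (identified with $\mathbb{R}^{V}$). Define $\mathcal{F}_{h_1,h_2}:L^\infty(V)\to L^\infty(V)$ by $$\mathcal{F}_{h_1,h_2}(u)(x)=-\Delta u(x)+h_1(x)e^{Au(x)}+h_2(x)e^{-Bu(x)}.$$ Let $B_R=\{u\in L^\infty(V):\|u\|_\infty<R\}$. In the two cases considered, the Brouwer degree $\deg(\mathcal{F}_{h_1,h_2},B_R,0)$ is well-defined (no zero of the map on $\partial B_R$) for all sufficiently large $R$ and is then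 independent of $R$; the topological degree is $$\mathbf{d}_{h_1,h_2}=\lim_{R\to+\infty}\deg(\mathcal{F}_{h_1,h_2},B_R,0).$$ *)

(* Defs.v *)
From HB Require Import structures.
From mathcomp Require Import all_boot all_order all_algebra.
From mathcomp Require Import all_classical all_reals all_analysis.
Set Implicit Arguments.
Unset Strict Implicit.
Unset Printing Implicit Defensive.
Import Order.TTheory GRing.Theory Num.Theory.
Import numFieldNormedType.Exports.
Local Open Scope classical_set_scope.
Local Open Scope ring_scope.

Section BrouwerDegree.
Context {R : realType} {n : nat}.
Implicit Types (f g : 'rV[R]_n -> 'rV[R]_n) (W : set 'rV[R]_n) (p : 'rV[R]_n).

(* For open W, this is the boundary of W. *)
Definition boundary W : set 'rV[R]_n := closure W `\` W.

(* The triples (f, W, p) for which deg(f, W, p) is defined. *)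
Definition degree_admissible f W p : Prop :=
  [/\ open W, bounded_set W, {within closure W, continuous f}
    & ~ (f @` boundary W) p].

Definition C1_on f W : Prop :=
  (forall x, W x -> differentiable f x) /\
  (forall x, W x -> {for x, continuous (fun y => 'J f y)}).

Definition regular_value f W p : Prop :=
  forall x, W x -> f x = p -> \det ('J f x) != 0.

Definition regular_triple f W p : Prop :=
  [/\ degree_admissible f W p, C1_on f W & regular_value f W p].

(* If (f, W, p) is a regular triple then f^-1(p) meets W in a finite set. The
   library Jacobian acts on row vectors, so it is the transpose of the usual
   one; the determinant is the same. *)
Definition regular_degree f W p : int :=
  \sum_(x \in W `&` f @^-1` [set p]) sgz (\det ('J f x)).

(* g is C^1 with regular value p, and |g - f| < dist(p, f(boundary W)) on the
   closure of W. *)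
Definition regular_approximation f W p g : Prop :=
  regular_triple g W p /\
  (forall x y, closure W x -> boundary W y -> `|g x - f x| < `|f y - p|).

(* The two-step analytic definition of the Brouwer degree: the signed count of
   preimages if f is C^1 and p is a regular value, and otherwise that count for
   a regular approximation of f. For an admissible triple such approximations
   exist (Weierstrass, Sard) and all yield the same integer, which for a regular
   triple is that of f itself. The value is 0 if p is in f(boundary W). *)
Definition brouwer_degree f W p : int :=
  if `[< regular_triple f W p >] then regular_degree f W p
  else xget 0 [set d : int | exists2 g, regular_approximation f W p g
                                      & d = regular_degree g W p].

End BrouwerDegree.

Section FunctionsOnAFiniteSet.
Context {R : realType} {V : finType}.

(* The identification of V -> R with R^V. The library norm on row vectors is
   the maximum of the absolute values of the entries, so it is the norm of
   L^oo(V). *)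
Definition to_row (u : V -> R) : 'rV[R]_#|V| := \row_i u (enum_val i).
Definition of_row (v : 'rV[R]_#|V|) : V -> R := fun x => v ord0 (enum_rank x).

Definition row_map (F : (V -> R) -> (V -> R)) : 'rV[R]_#|V| -> 'rV[R]_#|V| :=
  fun v => to_row (F (of_row v)).

Definition Linfty_ball (r : R) : set 'rV[R]_#|V| := [set v | `|v| < r].

Definition ball_degree (F : (V -> R) -> (V -> R)) (r : R) : int :=
  brouwer_degree (row_map F) (Linfty_ball r) 0.

Definition has_topological_degree (F : (V -> R) -> (V -> R)) : Prop :=
  (\forall r \near +oo, degree_admissible (row_map F) (Linfty_ball r) 0) /\
  (exists d : int, \forall r \near +oo, ball_degree F r = d).

(* The limit is taken in R; it is meaningful when [has_topological_degree F]. *)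
Definition topological_degree (F : (V -> R) -> (V -> R)) : R :=
  lim (((ball_degree F r)%:~R : R) @[r --> +oo]).

(* The extrema of h over V; the point x0 only witnesses that V is nonempty. *)
Definition max_over (x0 : V) (h : V -> R) : R := \big[Num.max/h x0]_(x : V) h x.
Definition min_over (x0 : V) (h : V -> R) : R := \big[Num.min/h x0]_(x : V) h x.

(* E is the adjacency relation; w is only relevant on the edges. *)
Definition laplacian (E : rel V) (mu : V -> R) (w : V -> V -> R)
    (u : V -> R) : V -> R :=
  fun x => (mu x)^-1 * \sum_(y | E x y) w x y * (u y - u x).

Definition F_map (E : rel V) (mu : V -> R) (w : V -> V -> R)
    (A B : R) (h1 h2 : V -> R) (u : V -> R) : V -> R :=
  fun x => - laplacian E mu w u x
           + h1 x * expR (A * u x) + h2 x * expR (- B * u x).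

End FunctionsOnAFiniteSet.

(* Main.v *)
(* The map F is of class C^1, so its degree is a signed count of zeros as
   soon as 0 is a regular value; no homotopy argument is needed. Everything
   rests on the maximum principle: the Laplacian of u is nonpositive where u is
   maximal.
   If h2 > 0, then F(u) > 0 at a maximum point of u, so F has no zero and its
   degree is 0. If h2 < 0, then F satisfies a comparison principle, hence is
   injective, and its Jacobian has no real eigenvalue <= 0, hence has positive
   determinant; F also has a zero, obtained by Perron's method between two large
   constants. That zero is unique and is counted with sign +1. *)

Require Import Defs.
From HB Require Import structures.
From mathcomp Require Import all_boot all_order all_algebra.
From mathcomp Require Import all_classical all_reals all_analysis.
From mathcomp Require Import ring lra.
Import Order.TTheory GRing.Theory Num.Theory.
Import numFieldNormedType.Exports.
Local Open Scope ring_scope.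

(** * Differential calculus on row vectors and a sign criterion for determinants *)

Section RowVectors.
Context {R : realType}.

Lemma continuous_mx (T : topologicalType) m n (f : T -> 'M[R]_(m, n)) (x : T) :
  (forall i j, {for x, continuous (fun y => f y i j)}) -> {for x, continuous f}.
Proof.
move=> fx; apply/cvg_ballP => e e0.
have : \forall y \near x, forall i j, ball (f x i j) e (f y i j).
  apply: filter_forall => i; apply: filter_forall => j.
  by have /cvg_ballP := fx i j; apply.
by apply: filterS => y fy; split.
Qed.

Lemma rV_norm_le n (v : 'rV[R]_n) (r : R) :
  0 <= r -> (forall j, `|v ord0 j| <= r) -> `|v| <= r.
Proof.
move=> r0 vr; rewrite /Num.Def.normr /= mx_normrE.
by apply: bigmax_le => // -[i j] _ /=; rewrite ord1.
Qed.

Lemma is_diff_coord n (x : 'rV[R]_n) j :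
  is_diff x (fun v : 'rV[R]_n => v ord0 j) (fun v => v ord0 j).
Proof.
have lin : linear (fun v : 'rV[R]_n => v ord0 j : R^o).
  by move=> k u v; rewrite !mxE.
pose f : {linear 'rV[R]_n -> R^o} :=
  HB.pack (fun v : 'rV[R]_n => v ord0 j : R^o)
    (GRing.isLinear.Build _ _ _ _ _ lin).
have cf : continuous f by exact: coord_continuous.
apply: (@DiffDef _ _ _ _ _ f f); first exact: linear_differentiable.
exact: diff_lin.
Qed.

Lemma is_diff_sum (U W : normedModType R) (I : Type) (s : seq I) (P : pred I)
    (f df : I -> U -> W) x :
  (forall i, is_diff x (f i) (df i)) ->
  is_diff x (\sum_(i <- s | P i) f i) (\sum_(i <- s | P i) df i).
Proof.
move=> fd; elim/big_ind2: _ => [|g dg h dh gd hd|i _]; last exact: fd.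
  exact: is_diff_cst.
exact: is_diffD.
Qed.

(** A row-valued map is the sum of its entries times the basis rows, so it can be differentiated
    termwise. *)
Lemma is_diff_row (U : normedModType R) n (f df : U -> 'rV[R]_n) x :
  (forall j, is_diff x (fun y => f y ord0 j) (fun y => df y ord0 j)) ->
  is_diff x f df.
Proof.
move=> fd.
have rowE (g : U -> 'rV[R]_n) :
    g = \sum_(j < n) (( *:%R ^~ (delta_mx 0 j)) \o (fun y => g y ord0 j)).
  apply/funext => y; rewrite fct_sumE [LHS]row_sum_delta.
  by apply: eq_bigr.
by rewrite (rowE f) (rowE df); apply: is_diff_sum.
Qed.

Lemma is_diff_jacobian n (f df : 'rV[R]_n -> 'rV[R]_n) x :
  is_diff x f df -> 'J f x = lin1_mx df.
Proof. by move=> fd; rewrite /jacobian diff_val. Qed.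

Lemma is_diff_comp_derive (U : normedModType R) (g : U -> R) (dg : U -> R)
    (f : R -> R) (d : R) x :
  is_diff x g dg -> is_derive (g x) 1 f d ->
  is_diff x (f \o g) (fun y => d * dg y).
Proof.
move=> gd fd.
have fdiff : differentiable f (g x) by apply/derivable1_diffP; exact: ex_derive.
have f1 : is_diff (g x) f ( *:%R ^~ d).
  by apply: DiffDef => //; rewrite diff1E// derive1E derive_val.
have -> : (fun y => d * dg y) = ( *:%R ^~ d) \o dg.
  by apply/funext => y /=; rewrite mulrC.
exact: is_diff_comp.
Qed.

(* The characteristic polynomial of [- A] is monic and takes the value [\det A]
   at 0. *)
Lemma det_gt0_no_eigenvalue n (A : 'M[R]_n) :
  (forall t (v : 'rV_n), 0 <= t -> v *m - A = t *: v -> v = 0) -> 0 < \det A.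
Proof.
move=> noev; set p := char_poly (- A).
have p0 : p.[0] = \det A.
  by rewrite horner_coef0 char_poly_det -(scaleN1r A) detZ mulrA -exprMn
    mulrNN mulr1 expr1n mul1r.
rewrite ltNge; apply/negP => detA.
(* If [\det A <= 0], then [p] is nonpositive at 0 and positive past a Cauchy bound, so it has a root
   [t >= 0], an eigenvalue of [- A]. *)
have [b pb] := monic_Cauchy_bound (char_poly_monic (- A)).
have b0 : 0 <= Num.max 0 b by rewrite le_max lexx.
have pb0 : 0 <= p.[Num.max 0 b] by apply/ltW/pb; rewrite le_max lexx orbT.
have [|t /andP[t0 _]] := @poly_ivt _ p _ _ b0; first by rewrite p0 detA.
rewrite -eigenvalue_root_char => /eigenvalueP[v vA]; apply/negP; rewrite negbK.
by apply/eqP/(noev t).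
Qed.

End RowVectors.

(** * Degree on large balls for regular maps *)

Section DegreeOnBalls.
Context {R : realType} {V : finType}.
Implicit Types (F : (V -> R) -> V -> R) (u : V -> R).

Lemma to_rowK u : of_row (to_row u) = u.
Proof. by apply/funext => x; rewrite /of_row mxE enum_rankK. Qed.

Lemma of_rowK (v : 'rV[R]_#|V|) : to_row (of_row v) = v.
Proof. by apply/rowP => j; rewrite mxE /of_row enum_valK. Qed.

Lemma row_map_eq0 F v : row_map F v = 0 <-> F (of_row v) = (fun=> 0).
Proof.
split=> [F0|F0]; last by apply/rowP => j; rewrite !mxE F0.
rewrite -[LHS]to_rowK -/(row_map F v) F0.
by apply/funext => x; rewrite /of_row mxE.
Qed.

(** Boundary points lie outside the open ball, so having every zero inside rules out zeros on the
    boundary. *)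
Lemma regular_triple_ball F (r : R) :
  (forall v, differentiable (row_map F) v) ->
  (forall v, {for v, continuous (fun y => 'J (row_map F) y)}) ->
  (forall v, row_map F v = 0 -> `|v| < r) ->
  (forall v, row_map F v = 0 -> \det ('J (row_map F) v) != 0) ->
  regular_triple (row_map F) (Linfty_ball r) 0.
Proof.
move=> Fdiff JFcont F0r F0reg; split; first split.
- apply: (@open_comp _ _ (@Num.norm R 'rV[R]_#|V|) [set x | x < r]%classic).
    by move=> v _; exact: norm_continuous.
  exact: open_lt.
- exists r; split; first exact: num_real.
  by move=> M rM v /= vr; exact: ltW (lt_trans vr rM).
- by apply: continuous_subspaceT => v; exact: differentiable_continuous.
- by move=> [v [_ nvr] /F0r].
- by split=> v _.
- by move=> v _; exact: F0reg.
Qed.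

(** On a regular triple [brouwer_degree] is the signed count itself, so the limit is that of an
    eventually constant function. *)
Lemma topological_degree_near F (d : int) :
  (\forall r \near +oo, regular_triple (row_map F) (Linfty_ball r) 0 /\
     regular_degree (row_map F) (Linfty_ball r) 0 = d) ->
  has_topological_degree F /\ topological_degree F = d%:~R.
Proof.
move=> Fd.
have degF : \forall r \near +oo, ball_degree F r = d.
  apply: filterS Fd => r [Freg <-].
  by rewrite /ball_degree /brouwer_degree asboolT.
split; first split.
- by apply: filterS Fd => r [[]].
- by exists d.
- apply: norm_lim_near_cst.
  by apply: filterS degF => r ->.
Qed.

End DegreeOnBalls.

(** * The graph Laplacian and its maximum principle *)

Section MeanField.
Context {R : realType} {V : finType} (x0 : V) (E : rel V).
Context (mu : V -> R) (w : V -> V -> R).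
Hypothesis mu_gt0 : forall x, 0 < mu x.
Hypothesis w_gt0 : forall x y, E x y -> 0 < w x y.
Implicit Types u h : V -> R.

Lemma exists_maximum u : exists x, forall y, u y <= u x.
Proof.
case: (@arg_maxP _ _ _ x0 xpredT u) => // x _ xmax.
by exists x => y; exact: xmax.
Qed.

Lemma laplacian_cst (r : R) x : laplacian E mu w (fun=> r) x = 0.
Proof. by rewrite /laplacian big1 ?mulr0// => y _; rewrite subrr mulr0. Qed.

Lemma laplacianN u x :
  laplacian E mu w (fun y => - u y) x = - laplacian E mu w u x.
Proof.
by rewrite /laplacian -mulrN -sumrN; congr (_ * _); apply: eq_bigr => y _; ring.
Qed.

(** The Laplacian at [x] sees only the increments from [x], with positive coefficients; the maximum
    principle is used in this form. *)
Lemma le_laplacian u (v : V -> R) x : (forall y, u y - u x <= v y - v x) ->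
  laplacian E mu w u x <= laplacian E mu w v x.
Proof.
move=> uv; rewrite ler_pM2l ?invr_gt0//; apply: ler_sum => y xy.
by rewrite ler_pM2l ?w_gt0.
Qed.

(** At a maximum point of [u - v] the increments of [u] are at most those of [v], so the hypothesis
    excludes [v < u] there; hence the maximum of [u - v] is nonpositive. *)
Lemma laplacian_comparison u (v : V -> R) :
  (forall x, v x < u x -> laplacian E mu w v x < laplacian E mu w u x) ->
  forall x, u x <= v x.
Proof.
move=> lap_lt; have [x xmax] := exists_maximum (fun y => u y - v y).
suff ux : u x <= v x.
  by move=> y; rewrite -subr_le0 (le_trans (xmax y))// subr_le0.
rewrite leNgt; apply/negP => /lap_lt; apply/negP; rewrite -leNgt.
apply: le_laplacian => y; have := xmax y; lra.
Qed.

Lemma expR_dominates (a b p q : R) : 0 < a -> 0 < p + q ->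
  \forall r \near +oo, b * expR (- q * r) <= a * expR (p * r).
Proof.
move=> a0 pq0; near=> r.
(* From this threshold on, [1 + (p + q) * r], a lower bound for [expR ((p + q) * r)], is at least
   [b / a]. *)
have rb : b / a / (p + q) <= r.
  by near: r; apply: nbhs_pinfty_ge; exact: num_real.
have -> : p * r = (p + q) * r + - q * r by ring.
rewrite expRD mulrA ler_pM2r ?expR_gt0// -ler_pdivrMl//.
apply: le_trans (expR_ge1Dx _); rewrite mulrC.
by move: rb; rewrite ler_pdivrMr//; lra.
Unshelve. all: by end_near. Qed.

(** * The map [F] and its differential *)

Context (A B : R) (h1 h2 : V -> R).
Hypothesis A_gt0 : 0 < A.
Hypothesis B_gt0 : 0 < B.
Hypothesis h1_gt0 : forall x, 0 < h1 x.

Local Notation F := (F_map E mu w A B h1 h2).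

(** The derivative of [h1 x * expR (A * s) + h2 x * expR (- B * s)] at [s = u x]; the linearization
    [F_diff] of [F] at [u] is thus a Schrödinger operator with this potential. *)
Definition potential u x : R :=
  h1 x * A * expR (A * u x) - h2 x * B * expR (- B * u x).

Definition F_diff u h x : R := - laplacian E mu w h x + potential u x * h x.

Lemma is_diff_laplacian x (a : 'rV[R]_#|V|) :
  is_diff a (fun v => laplacian E mu w (of_row v) x)
            (fun v => laplacian E mu w (of_row v) x).
Proof.
have -> : (fun v : 'rV[R]_#|V| => laplacian E mu w (of_row v) x) =
    (mu x)^-1 *: \sum_(y | E x y) (w x y *:
      ((fun v : 'rV[R]_#|V| => v ord0 (enum_rank y)) -
       (fun v : 'rV[R]_#|V| => v ord0 (enum_rank x)))).
  by apply/funext => v; rewrite /= fct_sumE.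
apply: is_diffZ; apply: is_diff_sum => y; apply: is_diffZ.
by apply: is_diffB; exact: is_diff_coord.
Qed.

Lemma is_diff_F (a : 'rV[R]_#|V|) :
  is_diff a (row_map F) (row_map (F_diff (of_row a))).
Proof.
apply: is_diff_row => j; set x := enum_val j; set i := enum_rank x.
have expd (k : R) : is_diff a (expR \o (k *: (fun v : 'rV[R]_#|V| => v ord0 i)))
    (fun v => expR (k * a ord0 i) * (k * v ord0 i)).
  apply: (@is_diff_comp_derive _ _ _ _ expR).
  by apply: is_diffZ; exact: is_diff_coord.
have -> : (fun v => row_map F v ord0 j) =
    - (fun v => laplacian E mu w (of_row v) x) +
    h1 x *: (expR \o (A *: (fun v : 'rV[R]_#|V| => v ord0 i))) +
    h2 x *: (expR \o (- B *: (fun v : 'rV[R]_#|V| => v ord0 i))).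
  by apply/funext => v; rewrite mxE.
have -> : (fun v => row_map (F_diff (of_row a)) v ord0 j) =
    - (fun v => laplacian E mu w (of_row v) x) +
    h1 x *: (fun v : 'rV[R]_#|V| => expR (A * a ord0 i) * (A * v ord0 i)) +
    h2 x *: (fun v : 'rV[R]_#|V| => expR (- B * a ord0 i) * (- B * v ord0 i)).
  apply/funext => v; rewrite mxE /F_diff /potential -!/x /of_row -/i.
  rewrite !fctE/= /GRing.scale/=; ring.
exact: is_diffD (is_diffD (is_diffN (is_diff_laplacian x a))
  (is_diffZ (h1 x) (expd A))) (is_diffZ (h2 x) (expd (- B))).
Qed.

Lemma differentiable_F a : differentiable (row_map F) a.
Proof. by have [] := is_diff_F a. Qed.

Lemma continuous_F : continuous (row_map F).
Proof. by move=> a; exact/differentiable_continuous/differentiable_F. Qed.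

Lemma continuous_jacobian_F a :
  {for a, continuous (fun v => 'J (row_map F) v)}.
Proof.
have -> : (fun v => 'J (row_map F) v) =
    (fun v => lin1_mx (row_map (F_diff (of_row v)))).
  by apply/funext => v; apply: is_diff_jacobian; exact: is_diff_F.
apply: continuous_mx => i j; set x := enum_val j; set k := enum_rank x.
pose c : R := (of_row (delta_mx 0 i)) x.
pose l : R := laplacian E mu w (of_row (delta_mx 0 i)) x.
(* The Laplacian part is linear and contributes the constant [- l]; the entry depends on [v] only
   through its coordinate [k]. *)
have -> : (fun v => lin1_mx (row_map (F_diff (of_row v))) i j) =
    (fun v : 'rV[R]_#|V| => - l + (h1 x * A * expR (A * v ord0 k)
                      - h2 x * B * expR (- B * v ord0 k)) * c).
  by apply/funext => v; rewrite !mxE.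
have ck : {for a, continuous (fun v : 'rV[R]_#|V| => v ord0 k)}.
  exact: coord_continuous.
have ce (p : R) :
    {for a, continuous (fun v : 'rV[R]_#|V| => expR (p * v ord0 k))}.
  apply: (@continuous_comp _ _ _ (fun v : 'rV[R]_#|V| => p * v ord0 k) expR);
    last exact: continuous_expR.
  by apply: cvgM ck; exact: cvg_cst.
apply: (@continuousD _ _ _ (cst (- l))); first exact: cst_continuous.
apply: (@continuousM _ _ _ (cst c)); last exact: cst_continuous.
by apply: continuousB; apply: continuousM (ce _); exact: cst_continuous.
Qed.

Lemma F_gt0_at_max u x : 0 < h2 x -> (forall y, u y <= u x) -> 0 < F u x.
Proof.
move=> h2x xmax; rewrite /F_map -addrA ltr_wpDl//; last first.
  by rewrite addr_gt0// mulr_gt0// expR_gt0.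
rewrite oppr_ge0 -(laplacian_cst (u x) x); apply: le_laplacian => y.
by rewrite subrr subr_le0.
Qed.

(** * Negative [h2]: comparison, sign of the Jacobian and existence of a zero *)

Section NegativeH2.
Hypothesis h2_lt0 : forall x, h2 x < 0.

Lemma F_reaction_mono x :
  {mono (fun s : R => h1 x * expR (A * s) + h2 x * expR (- B * s)) :
    s t / s <= t}.
Proof.
apply: le_mono => s t st; apply: ltrD.
  by rewrite ltr_pM2l// ltr_expR ltr_pM2l.
by rewrite ltr_nM2l// ltr_expR !mulNr ltrN2 ltr_pM2l.
Qed.

(** Where [v x < u x], the reaction term is strictly larger for [u], so [F u x <= F v x] forces a
    strictly larger Laplacian for [u]. *)
Lemma F_comparison u (v : V -> R) :
  (forall x, F u x <= F v x) -> forall x, u x <= v x.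
Proof.
move=> Fuv; apply: laplacian_comparison => x vu.
have := Fuv x; have := F_reaction_mono x (u x) (v x).
by rewrite (lt_geF vu) /F_map => /negbT; rewrite -ltNge; lra.
Qed.

Lemma potential_gt0 u x : 0 < potential u x.
Proof.
rewrite /potential subr_gt0; apply: (@lt_trans _ _ 0).
  by rewrite pmulr_llt0 ?expR_gt0// pmulr_llt0.
by rewrite !mulr_gt0// expR_gt0.
Qed.

(** Where [h x > 0], the equation makes the Laplacian of [h] equal to
    [(potential u x + t) * h x > 0], so [h] compares with the zero function. *)
Lemma F_diff_eigenvector_le0 u h t : 0 <= t ->
  (forall x, F_diff u h x = - t * h x) -> forall x, h x <= 0.
Proof.
move=> t0 hF x; rewrite -[0]/((fun=> 0 : R) x).
apply: laplacian_comparison => {}x hx; rewrite laplacian_cst.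
have := hF x; have := mulr_ge0 t0 (ltW hx).
have := mulr_gt0 (potential_gt0 u x) hx.
rewrite /F_diff mulNr; lra.
Qed.

Lemma det_jacobian_F_gt0 a : 0 < \det ('J (row_map F) a).
Proof.
apply: det_gt0_no_eigenvalue => t v t0; rewrite mulmxN => /(congr1 -%R).
have Fd := is_diff_F a; rewrite opprK /jacobian mul_rV_lin1 diff_val => vt.
have ev x : F_diff (of_row a) (of_row v) x = - t * of_row v x.
  move: vt => /rowP/(_ (enum_rank x)); rewrite !mxE enum_rankK mulNr => <-.
  by [].
(* [- v] satisfies the same equation, so the bound applies to both signs and forces [v = 0]. *)
have evN x : F_diff (of_row a) (fun y => - of_row v y) x = - t * - of_row v x.
  rewrite mulrN -ev /F_diff laplacianN; ring.
have v_le0 := F_diff_eigenvector_le0 _ _ _ t0 ev.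
have v_ge0 := F_diff_eigenvector_le0 _ _ _ t0 evN.
rewrite -[v]of_rowK; apply/rowP => j; rewrite !mxE.
apply/le_anti/andP; split=> //.
by rewrite -oppr_le0.
Qed.

Lemma F_cst (r : R) x :
  F (fun=> r) x = h1 x * expR (A * r) + h2 x * expR (- B * r).
Proof. by rewrite /F_map laplacian_cst oppr0 add0r. Qed.

(** On constants only the exponentials remain: the positive [h1] term wins at [r], the negative [h2]
    term at [- r]. Finiteness of [V] lets one [r] serve all vertices. *)
Lemma constant_barriers : exists2 r : R, 0 <= r &
  forall x, F (fun=> - r) x <= 0 <= F (fun=> r) x.
Proof.
have AB : 0 < A + B by exact: addr_gt0.
near (@pinfty_nbhs R) => r; exists r; first by near: r; exact: nbhs_pinfty_ge.
near: r; apply: filter_forall => x.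
have h2N : 0 < - h2 x by rewrite oppr_gt0.
near=> r; rewrite !F_cst; apply/andP; split.
  have : h1 x * expR (- A * r) <= - h2 x * expR (B * r).
    by near: r; apply: expR_dominates => //; rewrite addrC.
  by rewrite !mulrN !mulNr opprK; lra.
have : - h2 x * expR (- B * r) <= h1 x * expR (A * r).
  by near: r; exact: expR_dominates.
lra.
Unshelve. all: by end_near. Qed.

(* Perron's method: a subsolution with the largest sum is a solution, because
   raising a single coordinate only decreases F at the other vertices. *)
Lemma F_has_zero : exists a, row_map F a = 0.
Proof.
have [r r0 barr] := constant_barriers.
(* The subsolutions bounded below by [- r]; comparison with the supersolution [r] bounds them above,
   so [K] is compact. *)
pose K := (\bigcap_j ([set a : 'rV[R]_#|V| | - r <= a ord0 j] `&`
                     [set a | row_map F a ord0 j <= 0]))%classic.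
have cont_Fj j : continuous (fun a => row_map F a ord0 j).
  move=> a; apply: (@continuous_comp _ _ _ _ (fun c : 'rV[R]_#|V| => c ord0 j)).
    exact: continuous_F.
  exact: coord_continuous.
have K_le a : K a -> forall x, of_row a x <= r.
  move=> Ka; apply: F_comparison => x.
  have /andP[_] := barr x; apply: le_trans.
  by have [_ /=] := Ka (enum_rank x) I; rewrite mxE enum_rankK.
have K0 : (K !=set0)%classic.
  exists (to_row (fun=> - r)) => j _ /=; split; first by rewrite mxE.
  by rewrite mxE to_rowK; have /andP[] := barr (enum_val j).
have closedK : closed K.
  apply: closed_bigI => j _; apply: closedI.
    exact: (iffLR (continuous_closedP _) (@coord_continuous R 1 #|V| ord0 j)
      _ (@closed_ge R (- r))).
  exact: (iffLR (continuous_closedP _) (cont_Fj j) _ (@closed_le R 0)).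
have boundedK : bounded_set K.
  exists r; split; first exact: num_real.
  move=> M rM a Ka; apply: le_trans (ltW rM); apply: rV_norm_le => // j.
  rewrite ler_norml; have [-> _] := Ka j I.
  by have := K_le _ Ka (enum_val j); rewrite /of_row enum_valK.
have cont_sum : continuous (fun a : 'rV[R]_#|V| => \sum_j a ord0 j).
  apply: continuous_big; first exact: add_continuous.
  by move=> j _; exact: coord_continuous.
have [a /set_mem Ka amax] := EVT_max_rV K0
  (bounded_closed_compact boundedK closedK) (continuous_subspaceT cont_sum).
exists a; apply/rowP => j; rewrite [RHS]mxE; apply/eqP; rewrite eq_le.
have [/= raj Faj] := Ka j I; rewrite Faj /= leNgt; apply/negP => Faj_lt0.
(* Raise coordinate [j] by [t]: by continuity [F] stays negative there for small [t > 0]. *)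
pose b : R -> 'rV[R]_#|V| := cst a + *:%R^~ (delta_mx 0 j).
have bE t i : b t ord0 i = a ord0 i + t *+ (i == j).
  by rewrite /b fctE/= !mxE eqxx /= mulr_natr.
have cont_b : {for 0, continuous (fun t => row_map F (b t) ord0 j)}.
  apply: (@continuous_comp _ _ _ b (fun a => row_map F a ord0 j) 0).
    by apply: continuousD; [exact: cst_continuous|exact: scalel_continuous].
  exact: cont_Fj.
have b_lt0 : \forall t \near (0^'+)%classic, row_map F (b t) ord0 j < 0.
  apply: (cvgr_lt _ (cvg_at_right_filter cont_b)).
  by rewrite /b fctE/= scale0r addr0.
near (at_right (0 : R)) => t.
have t0 : 0 < t by near: t; exact: nbhs_right_gt.
have bj : row_map F (b t) ord0 j < 0 by near: t.
(* The sum of coordinates grows by [t], against the maximality of [a]. *)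
suff Kb : K (b t).
  have := amax _ (mem_set Kb); under eq_bigr do rewrite bE.
  rewrite big_split/= gerDl (bigD1 j)//= eqxx big1 => [|i /negPf->//].
  by rewrite addr0 leNgt t0.
move=> i _ /=; have [rai Fai] := Ka i I; split.
  by rewrite bE (le_trans rai)// lerDl mulrn_wge0// ltW.
have [->|ij] := eqVneq i j; first exact: ltW.
(* At another vertex the value is unchanged and the increments from it can only grow, so [F] does
   not increase. *)
apply: le_trans Fai; rewrite !mxE /F_map.
have bi : of_row (b t) (enum_val i) = of_row a (enum_val i).
  by rewrite /of_row bE enum_valK (negPf ij) mulr0n addr0.
rewrite bi !lerD2r lerN2; apply: le_laplacian => y; rewrite bi lerD2r.
by rewrite /of_row bE lerDl mulrn_wge0// ltW.
Unshelve. all: by end_near. Qed.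

End NegativeH2.
End MeanField.

(** * Counting the zeros in the two cases *)

Theorem theorem1 (R : realType) (V : finType) (x0 : V) (E : rel V)
    (mu : V -> R) (w : V -> V -> R) (h1 h2 : V -> R) (A B : R)
    (E_sym : symmetric E)
    (E_connected : forall x y : V, connect E x y)
    (mu_gt0 : forall x, 0 < mu x)
    (w_sym : forall x y, E x y -> w x y = w y x)
    (w_gt0 : forall x y, E x y -> 0 < w x y)
    (h1_gt0 : forall x, 0 < h1 x)
    (A_gt0 : 0 < A) (B_gt0 : 0 < B) :
  (max_over x0 h2 < 0 ->
     has_topological_degree (F_map E mu w A B h1 h2) /\
     topological_degree (F_map E mu w A B h1 h2) = 1) /\
  (0 < min_over x0 h2 ->
     has_topological_degree (F_map E mu w A B h1 h2) /\
     topological_degree (F_map E mu w A B h1 h2) = 0).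
Proof.
set F := F_map E mu w A B h1 h2.
have Fdiff := @differentiable_F R V E mu w A B h1 h2.
have JFcont := @continuous_jacobian_F R V E mu w A B h1 h2.
split=> [/bigmax_ltP[_ h2_lt0]|/bigmin_gtP[_ h2_gt0]].
- have [a Fa] : exists a, row_map F a = 0.
    by apply: F_has_zero => // x; exact: h2_lt0.
  have detF v : 0 < \det ('J (row_map F) v).
    by apply: det_jacobian_F_gt0 => // x; exact: h2_lt0.
  have a_uniq v : row_map F v = 0 -> v = a.
    move=> /row_map_eq0 Fv; move/row_map_eq0 : Fa => Fa.
    have cmp := @F_comparison R V x0 E mu w mu_gt0 w_gt0 A B h1 h2 A_gt0 B_gt0
      h1_gt0 (fun x => h2_lt0 x isT).
    rewrite -[v]of_rowK -[a]of_rowK; congr to_row; apply/funext => x.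
    (* Both zeros have the same image, so comparison applies in both directions. *)
    by apply/le_anti/andP; split; apply: cmp => y; rewrite -/F Fa Fv.
  apply: (@topological_degree_near _ _ _ 1); near=> r.
  have ar : `|a| < r by near: r; apply: nbhs_pinfty_gt; exact: num_real.
  split.
    apply: regular_triple_ball => // v; first by move=> /a_uniq ->.
    by move=> _; rewrite gt_eqF.
  rewrite /regular_degree.
  have -> : (Linfty_ball r `&` row_map F @^-1` [set 0] = [set a])%classic.
    apply/seteqP; split=> [v [_ /a_uniq->]//|v ->]; split=> //.
  by rewrite fsbig_set1 gtr0_sgz.
- have F_neq0 v : row_map F v <> 0.
    move=> /row_map_eq0 Fv.
    have [x xmax] := exists_maximum x0 (of_row v).
    have := @F_gt0_at_max R V E mu w mu_gt0 w_gt0 A B h1 h2 h1_gt0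
      (of_row v) x (h2_gt0 x isT) xmax.
    by rewrite -/F Fv ltxx.
  apply: (@topological_degree_near _ _ _ 0); near=> r.
  split; first by apply: regular_triple_ball => // v /F_neq0.
  rewrite /regular_degree.
  have -> : (Linfty_ball r `&` row_map F @^-1` [set 0] = set0)%classic.
    by apply/seteqP; split=> // v [_ /F_neq0].
  exact: fsbig_set0.
Unshelve. all: by end_near. Qed.
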